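(* Let $G$ be a connected $c$-edge-colored multigraph on $n\ge 4$ vertices with $m$ edges, where $c\ge 3$. If the rainbow degree of $G$ equals $c$ and $m\ge c\binom{n-1}{2}+c+1$, then $G$ has a proper Hamiltonian cycle.
   Context: A $c$-edge-colored multigraph has each edge colored with one color from $\{1,\dots,c\}$, and no two edges joining the same pair of vertices have the same color (no loops); $m$ counts all edges including parallel ones. Throughout, multigraphs are assumed connected. The rainbow degree of a vertex is the number of distinct colors on edges incident to it; the rainbow degree of the multigraph is the minimum over its vertices. A proper Hamiltonian cycle is a cycle through all vertices in which any two consecutive edges have different colors. *)

(* Defs.v *)
From mathcomp Require Import all_boot.

Set Implicit Arguments.
Unset Strict Implicit.
Unset Printing Implicit Defensive.

(* An edge is a pair (set of its two ends, colour).  Taking a *set* of such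
   pairs forbids exactly parallel edges of the same colour, and two-element
   ends forbid loops. *)
Record ecmultigraph (c : nat) (V : finType) := ECMultigraph {
  edges : {set {set V} * 'I_c};
  edges_ends : forall e, e \in edges -> #|e.1| = 2 }.

Section ECMultigraph.

Variables (c : nat) (V : finType).
Implicit Types (G : ecmultigraph c V) (x y : V) (i : 'I_c).

Definition joins G i x y : bool := ([set x; y], i) \in edges G.

Definition adjacent G x y : bool := [exists i, joins G i x y].

Definition connected G : Prop := forall x y, connect (adjacent G) x y.

Definition vertex_rainbow_degree G x : nat :=
  #|[set e.2 | e in edges G & x \in e.1]|.

(* Every vertex has rainbow degree at most c, so the default value c does not
   affect the minimum as soon as V is nonempty. *)
Definition rainbow_degree G : nat :=
  \big[minn/c]_(x : V) vertex_rainbow_degree G x.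

(* A closed walk is a cyclic list of pairs (vertex, colour of the edge from
   that vertex to the next one); [cycle] includes the step from the last pair
   back to the first, for the edges as well as for the colours. *)
Definition proper_step G (a b : V * 'I_c) : bool :=
  joins G a.2 a.1 b.1 && (a.2 != b.2).

Definition proper_hamiltonian_cycle G (p : seq (V * 'I_c)) : Prop :=
  [/\ cycle (proper_step G) p, uniq (unzip1 p) & forall x, x \in unzip1 p].

End ECMultigraph.

(* Main.v *)
(* Keep three colours whose classes have at least the average size: they miss
   at most [3n - 7] edges in all.  Induct on the number [n] of vertices, asking
   only that every vertex sees two colours.  A vertex [z] can be inserted in a
   proper Hamiltonian cycle of the others unless every place rejects it; a place
   rejects [z] only if two edges at [z] are missing, so by counting [z] can be
   inserted as soon as (missing edges at [z]) + (vertices they lead to) is less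
   than [2 (n - 1)].  Hence any such [z] with at least three missing edges can be
   removed.  If one vertex [u] misses at least [2n - 4] edges, the rest is so
   dense that the same insertion argument yields a proper Hamiltonian path
   between two neighbours of [u] with prescribed end colours.  Otherwise counting
   forces two vertices to carry almost all the missing edges, and a path in the
   complement of one of them again closes up to a cycle. *)
Require Import Defs.
From mathcomp Require Import all_boot.
From mathcomp Require Import zify.

Set Implicit Arguments.
Unset Strict Implicit.
Unset Printing Implicit Defensive.

(** * Choosing distinct elements of finite sets *)

Lemma card_pick_neq (T : finType) (A B : {set T}) :
  1 < #|A| -> 0 < #|B| -> exists a b, [/\ a \in A, b \in B & a != b].
Proof.
move=> A2 /card_gt0P[b bB].
have /card_gt0P[a] : 0 < #|A :\ b|.
  by have := cardsD1 b A; case: (b \in A) => /=; lia.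
by rewrite !inE => /andP[ab aA]; exists a, b.
Qed.

Lemma perm_enum_setD1 (T : finType) (A : {set T}) x :
  x \in A -> perm_eq (enum A) (x :: enum (A :\ x)).
Proof.
move=> xA; apply: uniq_perm; rewrite /= ?enum_uniq ?mem_enum ?inE ?eqxx // => y.
by rewrite inE !mem_enum !inE; case: eqP => // ->.
Qed.

(** * Missing edges in three colours *)

Section ThreeColours.

Variables (V C : finType) (P : C -> rel V).
Hypothesis Psym : forall c, symmetric (P c).
Hypothesis card_C : #|C| = 3.

Definition proper_next (s t : V * C) := P s.2 s.1 t.1 && (s.2 != t.2).

Definition missing x y : {set C} := [set c | (x != y) && ~~ P c x y].

Definition mu x y := #|missing x y|.

(** For an edge [xy] next to an edge of colour [a]: only the other two colours are usable, and these
    are the ones among them that are missing. *)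
Definition mu_avoid a x y := #|missing x y :\ a|.

Definition deficit (W : {set V}) v := \sum_(x in W) mu v x.

(* Every missing edge inside [W] is counted twice. *)
Definition total (W : {set V}) := \sum_(v in W) deficit W v.

Definition support (W : {set V}) v := \sum_(x in W) (0 < mu v x).

Definition spanning_cycle (W : {set V}) p :=
  cycle proper_next p /\ perm_eq (unzip1 p) (enum W).

Lemma missingC x y : missing x y = missing y x.
Proof. by apply/setP=> c; rewrite !inE eq_sym Psym. Qed.

Lemma muC x y : mu x y = mu y x.
Proof. by rewrite /mu missingC. Qed.

Lemma muxx x : mu x x = 0.
Proof. by apply/eqP; rewrite cards_eq0; apply/eqP/setP=> c; rewrite !inE eqxx. Qed.

Lemma mem_avail x y c : x != y -> (c \in ~: missing x y) = P c x y.
Proof. by move=> xy; rewrite !inE xy negbK. Qed.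

Lemma card_avail x y : #|~: missing x y| = 3 - mu x y.
Proof. by have := cardsC (missing x y); rewrite card_C /mu; lia. Qed.

Lemma card_avail_avoid a x y : #|~: missing x y :\ a| = 2 - mu_avoid a x y.
Proof.
rewrite /mu_avoid; have -> : ~: missing x y :\ a = ~: (a |: missing x y).
  by apply/setP=> c; rewrite !inE negb_or.
have := cardsC (a |: missing x y); rewrite card_C cardsU1.
by have := cardsD1 a (missing x y); case: (a \in _) => /=; lia.
Qed.

Lemma mu_avoidC a x y : mu_avoid a x y = mu_avoid a y x.
Proof. by rewrite /mu_avoid missingC. Qed.

Lemma mu_avoid_le a x y : mu_avoid a x y <= mu x y.
Proof. by rewrite subset_leq_card // subD1set. Qed.

(** * Inserting a vertex in a path or a cycle *)

Definition weight x y := mu x y + (0 < mu x y).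

(** A missing colour is counted once if it is [a] or [b] and twice otherwise; with three colours,
    only one is neither. *)
Lemma mu_avoid2 a b x y : a != b ->
  mu_avoid a x y + mu_avoid b x y <= weight x y.
Proof.
move=> ab; rewrite /weight.
have := cardsD1 a (missing x y); have := cardsD1 b (missing x y).
have := cardsD1 b (missing x y :\ a); rewrite -/(mu x y) -/(mu_avoid a x y).
rewrite -/(mu_avoid b x y) !inE [b == a]eq_sym ab /=.
have : #|missing x y :\ a :\ b| <= 1.
  have ->: missing x y :\ a :\ b = missing x y :&: ~: [set a; b].
    apply/setP=> c; rewrite !inE negb_or.
    by case: (c == a); case: (c == b); rewrite ?andbF ?andbT.
  apply: leq_trans (subset_leq_card (subsetIr _ _)) _.
  by have := cardsC [set a; b]; rewrite cards2 ab card_C; lia.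
lia.
Qed.

(** One of the two new edges keeps two usable colours and the other at least one, so they can be
    coloured differently. *)
Lemma insert_colours (x z y : V) (a b : C) : x != z -> z != y ->
    mu_avoid a x z + mu_avoid b z y <= 1 ->
  exists c1 c2, [/\ P c1 x z, P c2 z y, a != c1, c1 != c2 & c2 != b].
Proof.
move=> xz zy le1; have := card_avail_avoid a x z; have := card_avail_avoid b z y.
have [h|h] := leqP (mu_avoid a x z) 0 => ? ?.
  have [||c1 [c2 []]] := @card_pick_neq _ (~: missing x z :\ a) (~: missing z y :\ b); try lia.
  rewrite ![_ \in _ :\ _]in_setD1 !mem_avail // => /andP[? ?] /andP[? ?] ?.
  by exists c1, c2; rewrite [a == _]eq_sym.
have [||c2 [c1 []]] := @card_pick_neq _ (~: missing z y :\ b) (~: missing x z :\ a); try lia.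
rewrite ![_ \in _ :\ _]in_setD1 !mem_avail // => /andP[? ?] /andP[? ?] ?.
by exists c1, c2; rewrite [a == _]eq_sym [c1 == c2]eq_sym.
Qed.

(* A place between two consecutive vertices rejects [z] only when two of the
   four relevant edges are missing, and a vertex [t] of the path contributes at
   most [weight z t] to its two places. *)
Lemma path_insert z o x e s l :
    path proper_next o ((x, e) :: rcons s l) ->
    z != x -> z != l.1 -> z \notin unzip1 s ->
    mu_avoid o.2 z x + \sum_(t <- unzip1 s) weight z t + mu_avoid l.2 z l.1
      < (size s).+1.*2 ->
  exists e' s', [/\ path proper_next o ((x, e') :: rcons s' l),
    perm_eq (unzip1 s') (z :: unzip1 s) &
    s != [::] -> e' = e \/ last (x, e') s' = last (x, e) s].
Proof.
elim: s o x e => [|[t f] s IH] o x e /=.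
  rewrite !andbT big_nil => /andP[ox xl] zx zl _ lt2.
  have [||c1 [c2 [p1 p2 n1 n2 n3]]] := @insert_colours x z l.1 o.2 l.2 _ zl.
  - by rewrite eq_sym.
  - by rewrite mu_avoidC; lia.
  exists c1, [:: (z, c2)]; split=> //=.
  by move: ox; rewrite /proper_next /= => /andP[-> _]; rewrite n1 p1 n2 p2 n3.
rewrite inE negb_or big_cons => /and3P[ox xt pth] zx zl /andP[zt zs] lt2.
have [le1|gt1] := leqP (mu_avoid o.2 z x + mu_avoid f z t) 1.
  have [||c1 [c2 [p1 p2 n1 n2 n3]]] := @insert_colours x z t o.2 f _ zt.
  - by rewrite eq_sym.
  - by rewrite mu_avoidC.
  exists c1, ((z, c2) :: (t, f) :: s).
  split=> //=; last by right.
  move: ox; rewrite /proper_next /= => /andP[-> _]; rewrite n1 p1 n2 p2 n3 /=.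
  by move: pth.
have [||e' [s' [/=/andP[xt' pth'] perm_s' lst]]] := IH (x, e) t f _ zt zl zs.
- by rewrite /= xt.
(* The rejecting place uses up 2 of the budget, as much as the bound drops for the shorter path;
   [mu_avoid2] splits [weight z t] between the two places next to [t]. *)
- rewrite /=; have /andP[_ /= ef] := xt; have := @mu_avoid2 e f z t ef; lia.
exists e, ((t, e') :: s'); split=> /=; last by left.
- by rewrite ox xt'.
- rewrite -[z :: t :: _]/([:: z] ++ [:: t] ++ unzip1 s) perm_sym perm_catCA /=.
  by rewrite perm_cons perm_sym.
Qed.

(** Cut at its first vertex [x], the cycle becomes a path from [x] back to [x], entered from its own
    last pair [o]. *)
Lemma cycle_insert z p : 1 < size p -> cycle proper_next p ->
    z \notin unzip1 p -> \sum_(t <- unzip1 p) weight z t < (size p).*2 ->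
  exists2 q, cycle proper_next q & perm_eq (unzip1 q) (z :: unzip1 p).
Proof.
case: p => [//|[x e] s] /= s0 cyc; rewrite inE negb_or => /andP[zx zs].
rewrite big_cons => lt2; set o := last (x, e) s.
have ox : proper_next o (x, e) by move: cyc; rewrite rcons_path => /andP[].
have [||e' [s' [/=/andP[ox' pth] perm_s' lst]]] :=
    @path_insert z o x e s (x, e) _ zx zx zs.
- by rewrite /= ox.
- have /andP[_ /= oe] := ox; have := @mu_avoid2 o.2 e z x oe => /=; lia.
exists ((x, e') :: s'); rewrite /=.
  (* The path closes up again because the insertion preserves the first colour or the last pair. *)
  have sN : s != [::] by case: (s) s0.
  case: (lst sN) pth => [-> //|lst2].
  by rewrite !rcons_path lst2 ox' => /andP[-> _].
rewrite -[z :: x :: _]/([:: z] ++ [:: x] ++ unzip1 s) perm_sym perm_catCA /=.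
by rewrite perm_cons perm_sym.
Qed.

(** * Counting missing edges; paths with prescribed ends *)

Lemma deficitD1 (W : {set V}) z v : z \in W -> deficit W v = mu v z + deficit (W :\ z) v.
Proof. by move=> zW; rewrite /deficit (big_setD1 z). Qed.

Lemma totalD1 (W : {set V}) z : z \in W -> total W = (deficit W z).*2 + total (W :\ z).
Proof.
move=> zW; rewrite /total (big_setD1 z zW) /=.
under [X in _ + X = _]eq_bigr => v _ do rewrite (deficitD1 _ zW) muC.
by rewrite big_split /= -/(deficit _ z) (deficitD1 z zW) muxx; lia.
Qed.

Lemma total_even W : ~~ odd (total W).
Proof.
move: {2}#|W| (erefl #|W|) => k.
elim: k W => [|k IH] W; first by move/eqP; rewrite cards_eq0 => /eqP->; rewrite /total big_set0.
move=> cW; have /card_gt0P[z zW] : 0 < #|W| by rewrite cW.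
rewrite (totalD1 zW) oddD odd_double IH //.
by have := cardsD1 z W; rewrite zW cW; lia.
Qed.

Lemma deficit_support (W : {set V}) v : \sum_(t in W) weight v t = deficit W v + support W v.
Proof. by rewrite big_split. Qed.

(* Twice the number of missing edges that are relevant to a path from [x] to
   [y] through [Z], when [x] is entered by colour [a] and [y] left by colour [b]. *)
Definition inner_total a x b y (Z : {set V}) :=
  (\sum_(z in Z) (mu_avoid a z x + mu_avoid b z y)).*2 + total Z.

Lemma inner_total_le a x b y (Z : {set V}) : x \notin Z -> y \notin Z -> x != y ->
  inner_total a x b y Z + (mu x y).*2 <= total (x |: (y |: Z)).
Proof.
move=> xZ yZ xy; have xyZ : x \notin y |: Z by rewrite !inE negb_or xy.
rewrite (totalD1 (setU11 _ _)) setU1K // (totalD1 (setU11 y Z)) setU1K //.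
rewrite (deficitD1 _ (setU11 x _)) setU1K // muxx (deficitD1 _ (setU11 y _)) setU1K //.
rewrite (deficitD1 y (setU11 y _)) setU1K // muxx /inner_total big_split /=.
suff H c u : \sum_(z in Z) mu_avoid c z u <= deficit Z u.
  by have := H a x; have := H b y; lia.
by apply: leq_sum => z _; rewrite muC mu_avoid_le.
Qed.

(** Induction on [#|Z|]: remove a vertex with a relevant missing edge if there is one, so that the
    bound survives, and put it back with [path_insert]. *)
Lemma proper_path v0 a x b y (Z : {set V}) :
    P a v0 x -> x \notin Z -> y \notin Z -> x != y ->
    0 < #|Z| -> inner_total a x b y Z <= #|Z|.*2 ->
  exists e s, path proper_next (v0, a) ((x, e) :: rcons s (y, b)) /\
    perm_eq (unzip1 s) (enum Z).
Proof.
move=> ax; move: {2}#|Z| (erefl #|Z|) => k.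
elim: k Z => [|k IH] Z cZ xZ yZ xy; first by rewrite cZ.
move=> _ leZ.
(* The relevant missing edges at [z]; removing [z] lowers [inner_total] by twice this number. *)
pose r z := mu_avoid a z x + mu_avoid b z y + deficit Z z.
have rD z : z \in Z -> inner_total a x b y Z =
    (r z).*2 + inner_total a x b y (Z :\ z).
  by move=> zZ; rewrite /inner_total (big_setD1 z zZ) /= (totalD1 zZ) /r; lia.
have [z zZ le_z] : exists2 z, z \in Z & inner_total a x b y (Z :\ z) <= k.*2.
  have [/existsP[z /andP[zZ rz]]|none] := boolP [exists z, (z \in Z) && (0 < r z)].
    by exists z => //; have := rD z zZ; lia.
  have r0 z : z \in Z -> r z = 0.
    move=> zZ; move: none; rewrite negb_exists => /forallP /(_ z).
    by rewrite zZ /= -leqNgt leqn0 => /eqP.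
  have /card_gt0P[z zZ] : 0 < #|Z| by rewrite cZ.
  exists z => //; suff: inner_total a x b y Z = 0 by have := rD z zZ; lia.
  rewrite /inner_total /total !big1 // => t /r0; rewrite /r; lia.
have cZz : #|Z :\ z| = k by have := cardsD1 z Z; rewrite zZ cZ; lia.
have rz : r z <= #|Z| by have := rD z zZ; lia.
have zx : z != x by apply: contraNneq xZ => <-.
have zy : z != y by apply: contraNneq yZ => <-.
case: k => [|k] in IH cZ cZz le_z *.
  have [||c1 [c2 [p1 p2 n1 n2 n3]]] := @insert_colours x z y a b _ zy.
  - by rewrite eq_sym.
  - by rewrite mu_avoidC; move: rz; rewrite /r cZ; lia.
  exists c1, [:: (z, c2)]; split; first by rewrite /= /proper_next /= ax n1 p1 n2 p2 n3.
  rewrite (_ : Z = [set z]) ?enum_set1 //.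
  by apply/eqP; rewrite eq_sym eqEcard sub1set zZ cards1 cZ.
have [||//|||e [s [pth perm_s]]] := IH (Z :\ z) cZz;
  rewrite ?inE ?(negPf xZ) ?(negPf yZ) ?andbF ?cZz //.
have zs : z \notin unzip1 s by rewrite (perm_mem perm_s) mem_enum !inE eqxx.
have ss : size s = k.+1 by rewrite -(size_map fst) (perm_size perm_s) -cardE cZz.
(* The cost of inserting [z] is [r z], at most [#|Z|], plus a support of at most [#|Z| - 1]: less
   than [2 * #|Z|]. *)
have [|e' [s' [pth' perm_s' _]]] := path_insert pth zx zy zs.
  rewrite (perm_big _ perm_s) /= big_enum /= deficit_support ss.
  have: support (Z :\ z) z <= #|Z :\ z|.
    by rewrite /support -sum1_card leq_sum // => t _; case: (0 < _).
  by move: rz; rewrite /r (deficitD1 _ zZ) muxx; lia.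
exists e', s'; split=> //; rewrite (perm_trans perm_s') //.
by rewrite perm_sym (perm_trans (perm_enum_setD1 zZ)) // perm_cons perm_sym.
Qed.

(** * One vertex with almost all the missing edges *)

Definition colours (W : {set V}) v := [set c | [exists x in W :\ v, P c v x]].

(** A vertex seeing at most one colour misses at least two edges to each of the [#|W| - 1]
    others. *)
Lemma card_colours (W : {set V}) v : v \in W ->
  deficit W v + 2 < #|W|.*2 -> 1 < #|colours W v|.
Proof.
move=> vW lt; rewrite ltnNge; apply/negP=> le1.
have : \sum_(x in W :\ v) 2 <= deficit (W :\ v) v.
  apply: leq_sum => x; rewrite in_setD1 => /andP[xv xW].
  have : #|~: colours W v| <= mu v x.
    apply/subset_leq_card/subsetP => c; rewrite !inE => /existsPn/(_ x).
    by rewrite in_setD1 xv xW [v == x]eq_sym xv.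
  by have := cardsC (colours W v); rewrite card_C; lia.
rewrite sum_nat_const; move: lt; rewrite (deficitD1 v vW) muxx (cardsD1 v) vW; lia.
Qed.

Lemma mem_colours (W : {set V}) v c : c \in colours W v ->
  exists x, [/\ x \in W, x != v & P c v x].
Proof.
by rewrite inE => /existsP[x]; rewrite !inE => /andP[/andP[? ?] ?]; exists x.
Qed.

Lemma distinct_neighbours (W : {set V}) v : v \in W -> 1 < #|colours W v| ->
    deficit W v + 6 < #|W| * 3 ->
  exists x y a b, [/\ [/\ x \in W, x != v & P a v x],
    [/\ y \in W, y != v & P b v y], x != y & a != b].
Proof.
move=> vW /card_gt1P[a [b [/mem_colours[x [xW xv ax]] /mem_colours[y [yW yv bY]] ab]]] lt.
have [xy|] := eqVneq x y; last by exists x, y, a, b.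
rewrite -{y}xy in yW yv bY.
(* Both colours lead to [x]. Another neighbour [t] suffices, since its colour differs from [a] or
   from [b]; without one, all [3(#|W| - 2)] edges from [v] to the other vertices would be
   missing. *)
have [/existsP[t /and3P[tW tv /existsP[c ct]]]|none] :=
  boolP [exists t, [&& t \in W :\ x, t != v & [exists c, P c v t]]].
  move: tW; rewrite !inE => /andP[tx tW].
  have [ca|ca] := eqVneq c a.
    by exists t, x, c, b; rewrite ca in ct *; split.
  by exists t, x, c, a; split.
have : \sum_(t in W :\ x :\ v) 3 <= deficit (W :\ x :\ v) v.
  apply: leq_sum => t; rewrite in_setD1 => /andP[tv tW].
  move/existsPn: none => /(_ t); rewrite tW tv /= => /existsPn nc.
  rewrite -card_C /mu subset_leq_card //; apply/subsetP=> c _.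
  by rewrite inE eq_sym tv nc.
rewrite sum_nat_const; move: lt.
have vWx : v \in W :\ x by rewrite !inE eq_sym xv.
rewrite (deficitD1 v xW) (deficitD1 v vWx).
rewrite (cardsD1 x W) xW (cardsD1 v (W :\ x)) vWx; lia.
Qed.

Lemma cycle_of_very_heavy (W : {set V}) u : u \in W -> 3 < #|W| ->
    1 < #|colours W u| -> total W + 14 <= 6 * #|W| ->
    #|W|.*2 <= deficit W u + 4 ->
  exists p, spanning_cycle W p.
Proof.
move=> uW W4 col2 tot heavy; have := totalD1 uW => totD.
have [|x [y [a [b [[xW xu ax] [yW yu bY] xy ab]]]]] := distinct_neighbours uW col2.
  lia.
pose Z := W :\ u :\ x :\ y.
have xWu : x \in W :\ u by rewrite !inE xu.
have yWux : y \in W :\ u :\ x by rewrite !inE eq_sym xy yu.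
have cZ : #|W| = #|Z|.+3.
  by rewrite (cardsD1 u) uW (cardsD1 x) xWu (cardsD1 y) yWux.
have xZ : x \notin Z by rewrite !inE eqxx andbF.
have yZ : y \notin Z by rewrite !inE eqxx.
have := inner_total_le a b xZ yZ xy; rewrite setD1K // setD1K // => leT.
have [||e [s [pth perm_s]]] := @proper_path u a x b y Z ax xZ yZ xy.
- by move: W4; rewrite cZ.
(* With [n = #|W|], [total (W :\ u)] is at most [6n - 14 - 2(2n - 4) = 2n - 6], which is
   [2 * #|Z|]. *)
- move: tot heavy leT; rewrite totD cZ.
  by move: (inner_total _ _ _ _ _) (total _) (deficit _ _) (mu _ _) #|Z|; clear; lia.
exists ((u, a) :: (x, e) :: rcons s (y, b)); split.
  rewrite -[cycle _ _]/(path proper_next (u, a) (rcons ((x, e) :: rcons s (y, b)) (u, a))).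
  by rewrite rcons_path pth last_cons last_rcons /proper_next /= Psym bY eq_sym.
rewrite perm_sym (perm_trans (perm_enum_setD1 uW)) //= perm_cons.
rewrite (perm_trans (perm_enum_setD1 xWu)) //= perm_cons /unzip1 map_rcons.
rewrite perm_sym perm_rcons perm_sym (perm_trans (perm_enum_setD1 yWux)) //=.
by rewrite perm_cons perm_sym.
Qed.

(** * Removing a light vertex, and the base case of three vertices *)

Lemma cycle_of_light (W : {set V}) z : z \in W -> 2 < #|W| ->
    deficit W z + support W z + 2 < #|W|.*2 ->
  (exists p, spanning_cycle (W :\ z) p) -> exists p, spanning_cycle W p.
Proof.
move=> zW W3 lt [p [cyc perm_p]].
have sz : size p = #|W|.-1.
  by rewrite -(size_map fst) (perm_size perm_p) -cardE (cardsD1 z W) zW.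
have [|||q cyc_q perm_q] := @cycle_insert z p _ cyc; first by lia.
- by rewrite (perm_mem perm_p) mem_enum !inE eqxx.
- rewrite (perm_big _ perm_p) big_enum deficit_support /= sz.
  move: lt; rewrite (deficitD1 z zW) /support (big_setD1 z zW) muxx /=; lia.
exists q; split=> //; rewrite (perm_trans perm_q) // perm_sym.
by rewrite (perm_trans (perm_enum_setD1 zW)) // perm_cons perm_sym.
Qed.

(** Three sets of at most two colours have total size at most 6, so one set is full; distinct
    choices in the other two leave it a third colour. Cyclic symmetry reduces to [full]. *)
Lemma triangle_colours (A B D : {set C}) :
    0 < #|A| -> 0 < #|B| -> 0 < #|D| -> 6 < #|A| + #|B| + #|D| ->
  exists a b d, [/\ a \in A, b \in B & d \in D] /\ [/\ a != b, b != d & d != a].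
Proof.
have full (A1 B1 D1 : {set C}) : 0 < #|A1| -> 0 < #|B1| -> #|D1| = 3 ->
    3 < #|A1| + #|B1| ->
    exists a b d, [/\ a \in A1, b \in B1 & d \in D1] /\ [/\ a != b, b != d & d != a].
  move=> A0 B0 D3 AB.
  have DT : D1 = setT by apply/eqP; rewrite eqEcard subsetT cardsT card_C D3.
  have [a [b [aA bB ab]]] : exists a b, [/\ a \in A1, b \in B1 & a != b].
    have [A2|A1_] := ltnP 1 #|A1|; first exact: card_pick_neq.
    have [|b [a [bB aA ba]]] := @card_pick_neq _ B1 A1 _ A0; first by lia.
    by exists a, b; rewrite eq_sym.
  have /card_gt0P[d] : 0 < #|~: [set a; b]|.
    by have := cardsC [set a; b]; rewrite cards2 ab card_C; lia.
  rewrite !inE negb_or => /andP[da db]; exists a, b, d.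
  by rewrite DT inE [b == d]eq_sym.
move=> A0 B0 D0 lt7.
have le3 (X : {set C}) : #|X| <= 3 by rewrite -card_C max_card.
have [D3|D3] := eqVneq #|D| 3; first by apply: full; lia.
have [A3|A3] := eqVneq #|A| 3.
  have [|b [d [a [[? ? ?] [? ? ?]]]]] := full B D A B0 D0 A3; first by lia.
  by exists a, b, d.
have [B3|B3] := eqVneq #|B| 3.
  have [|d [a [b [[? ? ?] [? ? ?]]]]] := full D A B D0 A0 B3; first by lia.
  by exists a, b, d.
by have := le3 A; have := le3 B; have := le3 D; lia.
Qed.

Lemma cycle_of_triangle (W : {set V}) : #|W| = 3 -> total W <= 4 ->
  exists p, spanning_cycle W p.
Proof.
move=> W3 tot.
have /card_gt2P[x [y [z [[xW yW zW] [xy yz zx]]]]] : 2 < #|W| by rewrite W3.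
have yWx : y \in W :\ x by rewrite !inE eq_sym xy.
have zWxy : z \in W :\ x :\ y by rewrite !inE zx eq_sym yz.
have tE : (mu x y + mu y z + mu z x).*2 <= total W.
  rewrite (totalD1 xW) (totalD1 yWx) (deficitD1 x xW) muxx (deficitD1 x yWx).
  rewrite (deficitD1 x zWxy) (deficitD1 y yWx) muxx (deficitD1 y zWxy).
  rewrite (muC z x); lia.
(* At most two edges are missing, so at least [9 - 2 = 7] are available, with at least one on each
   side. *)
have [||||a [b [c [[]]]]] :=
  @triangle_colours (~: missing x y) (~: missing y z) (~: missing z x);
  rewrite ?card_avail; try lia.
rewrite !mem_avail // => ax bY cz [ab bc ca].
exists [:: (x, a); (y, b); (z, c)]; split.
  by rewrite /= /proper_next /= ax bY cz ab bc ca.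
rewrite perm_sym (perm_trans (perm_enum_setD1 xW)) //= perm_cons.
rewrite (perm_trans (perm_enum_setD1 yWx)) //= perm_cons.
rewrite (perm_trans (perm_enum_setD1 zWxy)) //= perm_cons.
suff -> : W :\ x :\ y :\ z = set0 by rewrite enum_set0.
apply/eqP; rewrite -cards_eq0; move: W3.
by rewrite (cardsD1 x) xW (cardsD1 y) yWx (cardsD1 z) zWxy !add1n => -[->].
Qed.

(** * Two heavy vertices *)

Lemma supportD1 (W : {set V}) z v : z \in W ->
  support W v = (0 < mu v z) + support (W :\ z) v.
Proof. by move=> zW; rewrite /support (big_setD1 z). Qed.

Lemma support_le_deficit (W : {set V}) v : support W v <= deficit W v.
Proof. by apply: leq_sum => t _; case: (mu v t). Qed.

(** Outside the triple the support is at most the deficit, so a missing edge leaving the triple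
    counts at most twice, as in [total]. Inside, the deficits count each missing edge twice and the
    supports add at most one for each of the six ordered pairs. *)
Lemma three_heavy (W : {set V}) x y z :
    x \in W -> y \in W -> z \in W -> x != y -> y != z -> z != x ->
  deficit W x + support W x + (deficit W y + support W y)
    + (deficit W z + support W z) <= total W + 6.
Proof.
move=> xW yW zW xy yz zx.
have yWx : y \in W :\ x by rewrite !inE eq_sym xy.
have zWxy : z \in W :\ x :\ y by rewrite !inE zx eq_sym yz.
rewrite (totalD1 xW) (totalD1 yWx) (totalD1 zWxy).
rewrite !(deficitD1 _ xW) !(deficitD1 _ yWx) !(deficitD1 _ zWxy).
rewrite !(supportD1 _ xW) !(supportD1 _ yWx) !(supportD1 _ zWxy) !muxx.
rewrite (muC y x) (muC z x) (muC z y).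
have := support_le_deficit (W :\ x :\ y :\ z).
move: (support _) (deficit _) => s d sd.
move: (sd x) (sd y) (sd z); move: (s x) (s y) (s z) (d x) (d y) (d z).
move: (mu x y) (mu x z) (mu y z) (total _); clear; lia.
Qed.

(** On the cycle [w, u, z1, z2], colour [wu] first, then its two neighbouring edges; [z1 z2] has all
    three colours and can avoid both of theirs. *)
Lemma cycle_of_four (W : {set V}) u w z1 z2 :
    perm_eq (enum W) [:: u; w; z1; z2] ->
    mu u w <= 2 -> mu u z1 <= 1 -> mu w z2 <= 1 -> mu z1 z2 = 0 ->
  exists p, spanning_cycle W p.
Proof.
move=> perm_W uw uz wz zz.
have := perm_uniq perm_W; rewrite enum_uniq => /esym.
rewrite /= !inE !negb_or !andbT -!andbA => /and5P[nuw nuz1 nuz2 nwz1 /andP[nwz2 nz]].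
have /card_gt0P[c] : 0 < #|~: missing u w| by rewrite card_avail; lia.
rewrite mem_avail // => cP.
have [||a [c1 [aP /set1P-> ac]]] := @card_pick_neq _ (~: missing u z1) [set c].
- by rewrite card_avail; lia.
- by rewrite cards1.
have [||b [c2 [bP /set1P-> bc]]] := @card_pick_neq _ (~: missing w z2) [set c].
- by rewrite card_avail; lia.
- by rewrite cards1.
have /card_gt0P[d] : 0 < #|~: [set a; b]|.
  by have := cardsC [set a; b]; rewrite cards2 card_C; case: (a != b); lia.
have dP : d \in ~: missing z1 z2.
  by rewrite inE (_ : missing z1 z2 = set0) ?inE //; apply/eqP; rewrite -cards_eq0 -/(mu _ _) zz.
move: aP bP dP; rewrite !mem_avail // => aP bP dP.
rewrite !inE negb_or => /andP[da db].
exists [:: (w, c); (u, a); (z1, d); (z2, b)]; split.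
  rewrite /= /proper_next /= Psym cP [c == a]eq_sym ac aP [a == d]eq_sym da dP db.
  by rewrite Psym bP bc.
by rewrite perm_sym (perm_trans perm_W) //= (perm_catCA [:: u] [:: w]).
Qed.

(** A path [z1, w, ..., z2] is closed through [u]. This places two pairs with missing edges, [w z1]
    and [w z2], outside the count of [inner_total]. *)
Lemma cycle_of_two_heavy (W : {set V}) u w z1 z2 :
    u \in W -> w \in W -> z1 \in W -> z2 \in W -> uniq [:: u; w; z1; z2] ->
    4 < #|W| -> deficit W z1 <= 2 -> deficit W z2 <= 2 ->
    0 < mu w z1 -> 0 < mu w z2 ->
    total W + 4 <= (deficit W u).*2 + #|W|.*2 ->
  exists p, spanning_cycle W p.
Proof.
move=> uW wW z1W z2W; rewrite /= !inE !negb_or !andbT -!andbA.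
move=> /and5P[nuw nuz1 nuz2 nwz1 /andP[nwz2 nz]] W5 d1 d2 m1 m2 tot.
have z1Wu : z1 \in W :\ u by rewrite !inE eq_sym nuz1.
have wWuz : w \in W :\ u :\ z1 by rewrite !inE nwz1 eq_sym nuw.
have z2Wuzw : z2 \in W :\ u :\ z1 :\ w.
  by rewrite !inE [z2 == w]eq_sym nwz2 [z2 == z1]eq_sym nz [z2 == u]eq_sym nuz2.
pose Z := W :\ u :\ z1 :\ w :\ z2.
have cZ : #|W| = #|Z|.+4.
  by rewrite (cardsD1 u) uW (cardsD1 z1) z1Wu (cardsD1 w) wWuz (cardsD1 z2) z2Wuzw.
have wZ : w \notin Z by rewrite !inE eqxx andbF.
have z2Z : z2 \notin Z by rewrite !inE eqxx.
(* As [mu w z1] is positive, at least two colours remain for [u z1] and one for [z1 w]; likewise for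
   [z2] and [u]. *)
have e1 : mu u z1 + mu w z1 <= 2.
  apply: leq_trans d1; rewrite (deficitD1 _ uW) (deficitD1 _ z1Wu) muxx (deficitD1 _ wWuz).
  by rewrite !(muC z1); move: (deficit _ _) (mu _ _) (mu _ _); clear; lia.
have e2 : mu u z2 + mu w z2 <= 2.
  apply: leq_trans d2; rewrite (deficitD1 _ uW) (deficitD1 _ z1Wu) (deficitD1 _ wWuz).
  by rewrite !(muC z2); move: (deficit _ _) (mu _ z2) (mu _ z2) (mu _ z2); clear; lia.
have [||p [q [pP qP pq]]] := @card_pick_neq _ (~: missing u z1) (~: missing z1 w).
- by rewrite card_avail; move: m1 e1; clear; lia.
- by rewrite card_avail muC; move: m1 e1; clear; lia.
have [||r [p' [rP /set1P-> rp]]] := @card_pick_neq _ (~: missing z2 u) [set p].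
- by rewrite card_avail muC; move: m2 e2; clear; lia.
- by rewrite cards1.
move: pP qP rP; rewrite !mem_avail // 1?eq_sym // => pP qP rP.
have := inner_total_le q r wZ z2Z nwz2; rewrite setD1K // setD1K // => leT.
have [||e [s [pth perm_s]]] := @proper_path z1 q w r z2 Z qP wZ z2Z nwz2.
- by move: W5; rewrite cZ.
(* From [total (W :\ u) <= 2n - 4], the missing edges [w z1] and [w z2] save 2 each, leaving
   [2n - 8 = 2 * #|Z|]. *)
- move: tot leT; rewrite (totalD1 uW) (totalD1 z1Wu) cZ.
  rewrite (deficitD1 z1 z1Wu) muxx (deficitD1 z1 wWuz) (muC z1 w).
  move: m1 m2; move: (inner_total _ _ _ _ _) (total _) (deficit _ u) (deficit _ z1).
  by move: (mu w z1) (mu w z2) #|Z|; clear; lia.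
exists ((u, p) :: (z1, q) :: (w, e) :: rcons s (z2, r)); split.
  rewrite -[cycle _ _]/(proper_next (u, p) (z1, q) &&
    path proper_next (z1, q) (rcons ((w, e) :: rcons s (z2, r)) (u, p))).
  by rewrite rcons_path pth last_cons last_rcons /proper_next /= pP pq rP rp.
rewrite perm_sym (perm_trans (perm_enum_setD1 uW)) //= perm_cons.
rewrite (perm_trans (perm_enum_setD1 z1Wu)) //= perm_cons.
rewrite (perm_trans (perm_enum_setD1 wWuz)) //= perm_cons /unzip1 map_rcons.
rewrite perm_sym perm_rcons perm_sym (perm_trans (perm_enum_setD1 z2Wuzw)) //=.
by rewrite perm_cons perm_sym.
Qed.

(** The negation of the counting hypothesis of [cycle_of_light]. *)
Definition heavy (W : {set V}) v := #|W|.*2 <= deficit W v + support W v + 2.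

Lemma heavy_le2 (W : {set V}) : total W + 14 <= 6 * #|W| ->
  #|[set v in W | heavy W v]| <= 2.
Proof.
move=> tot; rewrite leqNgt; apply/negP=> /card_gt2P[x [y [z [[]]]]].
rewrite !inE => /andP[xW xh] /andP[yW yh] /andP[zW zh] [xy yz zx].
(* Three heavy vertices would give [6n - 6 <= total W + 6 <= 6n - 8]. *)
have := three_heavy xW yW zW xy yz zx; move: xh yh zh tot; rewrite /heavy.
move: (deficit W x + _) (deficit W y + _) (deficit W z + _) (total _) #|W|.
clear=> a b c t n; lia.
Qed.

(* With [total W = 2 t], every vertex that is not heavy misses at most
   [t + 9 - 3 n <= 2] edges, so that less than two heavy vertices cannot account
   for the value of [t]. *)
Lemma two_heavy_of_stuck (W : {set V}) : 3 < #|W| -> total W + 14 <= 6 * #|W| ->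
    {in W, forall v, deficit W v + 5 <= #|W|.*2} ->
    {in W, forall v, ~~ heavy W v -> 6 * #|W| + (deficit W v).*2 < total W + 20} ->
  exists u w, [/\ [/\ u \in W, w \in W & u != w], heavy W u /\ heavy W w,
    {in W, forall v, v != u -> v != w -> deficit W v <= 2} &
    total W + 4 <= (deficit W u).*2 + #|W|.*2].
Proof.
move=> W4 tot small stuck; set H := [set v in W | heavy W v].
have H2 : #|H| <= 2 by exact: heavy_le2.
have HW : H \subset W by apply/subsetP=> v; rewrite inE => /andP[].
have := total_even W; rewrite -dvdn2 => /dvdnP[t tE].
have cWH := cardsD W H; rewrite (setIidPr HW) in cWH.
have /card_gt0P[v0] : 0 < #|W :\: H| by move: cWH W4 H2; clear; lia.
rewrite !inE => /andP[v0H v0W]; move: (v0H); rewrite v0W /= => v0h.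
have [d tD] : exists d, t + 9 = 3 * #|W| + d.
  exists (t + 9 - 3 * #|W|); move: (stuck v0 v0W v0h); rewrite tE.
  by move: (deficit _ _) #|W|; clear; lia.
have d2 : d <= 2 by move: tot; rewrite tE; move: tD; move: #|W|; clear; lia.
have le_d v : v \in W -> v \notin H -> deficit W v <= d.
  move=> vW; rewrite inE vW /= => /(stuck v vW); rewrite tE.
  by move: tD; move: (deficit _ _) #|W|; clear; lia.
have sumWH : \sum_(v in W :\: H) deficit W v <= #|W :\: H| * d.
  by rewrite -sum_nat_const leq_sum // => v; rewrite inE => /andP[? ?]; apply: le_d.
have totE : total W = \sum_(v in H) deficit W v + \sum_(v in W :\: H) deficit W v.
  by rewrite /total (big_setID H) /= (setIidPr HW).
(* If [h = #|H|] were at most 1, then [2(3n - 9 + d) <= h(2n - 5) + (n - h)d], which fails for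
   [n >= 4] and [d <= 2]. *)
have cH : #|H| = 2.
  have sumH : \sum_(v in H) deficit W v <= #|H| * (#|W|.*2 - 5).
    rewrite -sum_nat_const leq_sum // => v; rewrite inE => /andP[vW _].
    by have := small v vW; move: (deficit _ _) #|W|; clear; lia.
  apply/eqP; rewrite eqn_leq H2 /=.
  move: totE sumWH sumH; rewrite tE cWH.
  move: tD d2 W4; move: (\sum_(v in H) _) (\sum_(v in W :\: H) _) => s1 s2.
  move: #|H| #|W| => h n; clear.
  case: h => [|[|//]]; case: d => [|[|[|//]]]; lia.
have /cards2P[u [w [uw HE]]] : #|H| == 2 by rewrite cH.
have /andP[uW uh] : (u \in W) && heavy W u.
  by have := set21 u w; rewrite -HE inE.
have /andP[wW wh] : (w \in W) && heavy W w.
  by have := set22 u w; rewrite -HE inE.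
exists u, w; split=> //.
  move=> v vW vu vw; apply: leq_trans d2; apply: le_d => //.
  by rewrite HE !inE negb_or vu.
(* The deficit of [w] is at most [2n - 5] and the light vertices contribute at most [(n - 2)d]; the
   rest of [total W] falls on [u]. *)
move: totE sumWH; rewrite tE cWH cH HE big_setU1 ?inE //= big_set1.
move: (small w wW) tD d2 W4; 
  move: (\sum_(v in _) _) (deficit W u) (deficit W w) #|W|.
clear=> s du dw n; case: d => [|[|[|//]]]; lia.
Qed.

Lemma missing_pair (W : {set V}) u w : u \in W -> w \in W -> u != w ->
    2 < support W w ->
  exists z1 z2, [/\ z1 \in W, z2 \in W, uniq [:: u; w; z1; z2], 0 < mu w z1 & 0 < mu w z2].
Proof.
move=> uW wW uw; have wWu : w \in W :\ u by rewrite !inE eq_sym uw.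
rewrite (supportD1 _ uW) (supportD1 _ wWu) muxx => s3.
have cardE : #|[set z in W :\ u :\ w | 0 < mu w z]| = support (W :\ u :\ w) w.
  rewrite -sum1_card; under eq_bigl => z do rewrite inE.
  by rewrite big_mkcondr; apply: eq_bigr => z _; case: (0 < _).
have /card_gt1P[z1 [z2 []]] : 1 < #|[set z in W :\ u :\ w | 0 < mu w z]|.
  by rewrite cardE; case: (0 < mu w u) s3 => /=; move: (support _ _); clear; lia.
rewrite !inE => /andP[/and3P[z1w z1u z1W] m1] /andP[/and3P[z2w z2u z2W] m2] nz.
exists z1, z2; split=> //=.
by rewrite !inE !negb_or uw ![u == _]eq_sym ![w == _]eq_sym z1u z2u z1w z2w nz.
Qed.

(** * The induction on the number of vertices *)

Lemma spanning_cycle_exists (W : {set V}) : 2 < #|W| ->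
    total W + 14 <= 6 * #|W| -> {in W, forall v, 1 < #|colours W v|} ->
  exists p, spanning_cycle W p.
Proof.
move: {2}#|W| (erefl #|W|) => k; elim: k W => [|k IH] W cW; first by rewrite cW.
move=> W3 tot col.
have [W3'|W3'] := eqVneq #|W| 3.
  by apply: cycle_of_triangle => //; move: tot; rewrite W3'; clear; lia.
have W4 : 3 < #|W| by rewrite ltn_neqAle eq_sym W3'.
have [/existsP[u /andP[uW uh]]|small] :=
  boolP [exists u, (u \in W) && (#|W|.*2 <= deficit W u + 4)].
  exact: cycle_of_very_heavy uW W4 (col u uW) tot uh.
have {}small : {in W, forall v, deficit W v + 5 <= #|W|.*2}.
  move=> v vW; move/existsPn: small => /(_ v); rewrite vW /=.
  by move: (deficit _ _) #|W|; clear; lia.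
(* The last condition says exactly that the bound on [total] survives the removal of [z]. *)
have [/existsP[z /and3P[zW zh le_z]]|stuck] := boolP [exists z,
  [&& z \in W, ~~ heavy W z & total W + 20 <= 6 * #|W| + (deficit W z).*2]].
  apply: (cycle_of_light zW W3); first by rewrite ltnNge.
  have cWz : #|W :\ z| = k by move: cW; rewrite (cardsD1 z) zW => -[].
  apply: IH; first by [].
  - by move: cW W4; rewrite cWz => ->.
  - move: le_z; rewrite cWz cW (totalD1 zW).
    by move: (total _) (deficit _ _); clear; lia.
  (* All deficits are at most [2n - 5], so every vertex still sees two colours without [z]. *)
  - move=> v vWz; apply: card_colours => //.
    have /andP[_ vW] : (v != z) && (v \in W) by rewrite -in_setD1.
    have := small v vW; rewrite cWz cW (deficitD1 v zW).
    by move: (deficit _ _) (mu _ _); clear; lia.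
have {}stuck : {in W, forall v, ~~ heavy W v ->
    6 * #|W| + (deficit W v).*2 < total W + 20}.
  by move=> v vW vh; move/existsPn: stuck => /(_ v); rewrite vW vh -ltnNge.
have [u [w [[uW wW uw] [uh wh] d2 tot_u]]] := two_heavy_of_stuck W4 tot small stuck.
(* Being heavy with deficit at most [2n - 5], [w] has support at least 3. *)
have [|z1 [z2 [z1W z2W uniq_z m1 m2]]] := missing_pair uW wW uw.
  have := small w wW; move: wh; rewrite /heavy.
  by move: (deficit _ _) (support _ _) #|W|; clear; lia.
move: (uniq_z); rewrite /= !inE !negb_or !andbT -!andbA.
move=> /and5P[_ nuz1 nuz2 nwz1 /andP[nwz2 nz]].
have [d1 d2'] : deficit W z1 <= 2 /\ deficit W z2 <= 2.
  by split; apply: d2; rewrite // eq_sym.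
have [W5|W5] := ltnP 4 #|W|.
  exact: (cycle_of_two_heavy uW wW z1W z2W uniq_z W5 d1 d2' m1 m2 tot_u).
have {W5}cW4 : #|W| = 4 by apply/eqP; rewrite eqn_leq W5.
have perm_W : perm_eq (enum W) [:: u; w; z1; z2].
  have [||_ memE] := uniq_min_size (s2 := enum W) uniq_z.
  - by move=> x; rewrite mem_enum !inE => /or4P[] /eqP->.
  - by rewrite -cardE cW4.
  by rewrite perm_sym uniq_perm ?enum_uniq.
have sumW (F : V -> nat) : \sum_(x in W) F x = F u + (F w + (F z1 + F z2)).
  by rewrite -big_enum (perm_big _ perm_W) /= !big_cons big_nil addn0.
have := small u uW; move: uh d1 d2'; rewrite /heavy cW4 /deficit /support !sumW !muxx.
rewrite (muC z1 u) (muC z2 u) (muC z1 w) (muC z2 w) (muC z2 z1) => h1 h2 h3 h4.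
(* For [n = 4], [u] has deficit and support 3, hence misses exactly one edge to each other vertex.
   With the edges missing to [w], this exhausts the deficits of [z1] and [z2]. *)
have [] : [/\ mu u w <= 2, mu u z1 <= 1, mu w z2 <= 1 & mu z1 z2 = 0].
  move: m1 m2 h1 h2 h3 h4.
  by move: (mu u w) (mu u z1) (mu u z2) (mu w z1) (mu w z2) (mu z1 z2); clear=> *; split; lia.
exact: cycle_of_four.
Qed.

End ThreeColours.

(** * From [c] colours to three *)

Lemma above_average_subset (I : finType) (f : I -> nat) t : #|I| * t < \sum_i f i ->
  forall k, 0 < k <= #|I| -> exists A : {set I}, #|A| = k /\ k * t < \sum_(i in A) f i.
Proof.
move=> lt k; have [j le_j] := ubnP (#|I| - k); elim: j k le_j => // j IH k le_j.
case/andP=> k0 kI; have [kE|kN] := eqVneq k #|I|.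
  exists setT; rewrite cardsT kE; split=> //.
  by under eq_bigl => i do rewrite inE.
have [||A [cA ltA]] := IH k.+1; [by lia | by rewrite /= ltn_neqAle kN |].
suff [i iA ltAi] : exists2 i, i \in A & k * t < \sum_(l in A :\ i) f l.
  by exists (A :\ i); split=> //; apply/eqP; rewrite -eqSS -cA (cardsD1 i A) iA.
(* Drop an element of value at most [t]; if there is none, all values exceed [t] and any element may
   go. *)
have [/existsP[i /andP[iA fi]]|none] := boolP [exists i, (i \in A) && (f i <= t)].
  exists i => //; move: ltA; rewrite (big_setD1 i iA) /= mulSn.
  by move: fi; move: (\sum_(l in _) _) (f i) (k * t); clear; lia.
have /card_gt0P[i iA] : 0 < #|A| by rewrite cA.
have cAi : #|A :\ i| = k by apply/eqP; rewrite -eqSS -cA (cardsD1 i A) iA.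
exists i => //; apply: (@leq_trans (\sum_(l in A :\ i) t.+1)).
  by rewrite sum_nat_const cAi ltn_pmul2l.
apply: leq_sum => l; rewrite in_setD1 => /andP[_ lA].
by move/existsPn: none => /(_ l); rewrite lA -ltnNge.
Qed.

(** Each edge is counted at both its ends, and the edges at [v] are among the images of [x] under
    [[set v; x]]. *)
Lemma pairs_sum (V : finType) (F : {set {set V}}) :
    (forall e, e \in F -> #|e| = 2) ->
  #|F|.*2 <= \sum_(v : V) \sum_(x : V) ((v != x) && ([set v; x] \in F)).
Proof.
move=> F2.
have -> : #|F|.*2 = \sum_(v : V) #|[set e in F | v \in e]|.
  transitivity (\sum_(e in F) \sum_(v : V) (v \in e)).
    rewrite (eq_bigr (fun=> 2)) => [|e eF]; first by rewrite sum_nat_const muln2.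
    by rewrite /= -(F2 e eF) -sum1_card [RHS]big_mkcond; apply: eq_bigr => v _; case: (_ \in _).
  rewrite exchange_big; apply: eq_bigr => v _; rewrite -sum1_card.
  under [RHS]eq_bigl => e do rewrite inE.
  by rewrite [RHS]big_mkcondr; apply: eq_bigr => e _; case: (_ \in _).
apply: leq_sum => v _.
pose S := [set x | (v != x) && ([set v; x] \in F)].
have -> : \sum_(x : V) ((v != x) && ([set v; x] \in F)) = #|S|.
  rewrite -sum1_card [RHS]big_mkcond; apply: eq_bigr => x _.
  by rewrite inE; case: (_ && _).
apply: leq_trans (leq_imset_card (fun x => [set v; x]) S).
apply/subset_leq_card/subsetP => e; rewrite inE => /andP[eF ve].
have /eqP/cards2P[x [y [xy eE]]] := F2 e eF.
move: ve eF; rewrite eE !inE => /orP[] /eqP vE eF.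
  by apply/imsetP; exists y; rewrite ?inE vE ?xy.
by apply/imsetP; exists x; rewrite ?inE vE ?[y == x]eq_sym ?xy setUC.
Qed.

Lemma bigmin_le (I : finType) c (F : I -> nat) i : \big[minn/c]_j F j <= F i.
Proof.
have : i \in index_enum I by rewrite mem_index_enum.
elim: (index_enum I) => [//|j s IH]; rewrite inE big_cons geq_min.
by case/predU1P => [->|/IH->]; rewrite ?leqnn ?orbT.
Qed.

Lemma double_bin2 n : 'C(n, 2).*2 = n * n.-1.
Proof. by have := bin_ffact n 2; rewrite !ffactnS ffactn0 muln1 muln2. Qed.

Section Reduction.

Variables (c : nat) (V : finType) (G : ecmultigraph c V).

Definition colour_class (j : 'I_c) := [set e | (e, j) \in edges G].

Lemma sum_colour_class : \sum_j #|colour_class j| = #|edges G|.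
Proof.
transitivity (\sum_j \sum_(e : {set V}) ((e, j) \in edges G)).
  apply: eq_bigr => j _; rewrite -sum1_card big_mkcond; apply: eq_bigr => e _.
  by rewrite inE; case: (_ \in _).
rewrite exchange_big pair_big -sum1_card [RHS]big_mkcond; apply: eq_bigr => -[e j] _ /=.
by case: (_ \in _).
Qed.

Lemma joins_sym j : symmetric (fun x y => joins G j x y).
Proof. by move=> x y; rewrite /joins setUC. Qed.

(** In each colour, an ordered pair of distinct vertices is either joined or missing. *)
Lemma total_colours k (f : 'I_k -> 'I_c) :
  total (fun i => joins G (f i)) setT + (\sum_i #|colour_class (f i)|).*2
    <= k * (#|V| * #|V|.-1).
Proof.
apply: (@leq_trans (total (fun i => joins G (f i)) setT +
  \sum_(i < k) \sum_(v : V) \sum_(x : V) ((v != x) && joins G (f i) v x))).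
  rewrite leq_add2l -mul2n big_distrr /=; apply: leq_sum => i _; rewrite mul2n.
  apply: leq_trans (pairs_sum _) _ => [e|].
    by rewrite inE => /(@edges_ends _ _ G).
  by apply: leq_sum => v _; apply: leq_sum => x _; rewrite inE.
have -> : total (fun i => joins G (f i)) setT =
    \sum_(i < k) \sum_(v : V) \sum_(x : V) ((v != x) && ~~ joins G (f i) v x).
  rewrite exchange_big /total /deficit /=; apply: eq_big => [v|v _]; first by rewrite inE.
  rewrite exchange_big /=; apply: eq_big => [x|x _]; first by rewrite inE.
  rewrite /mu -sum1_card big_mkcond; apply: eq_bigr => i _.
  by rewrite inE; case: (_ && _).
rewrite -big_split /=; apply: (@leq_trans (\sum_(i < k) #|V| * #|V|.-1)); last first.
  by rewrite sum_nat_const card_ord.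
apply: leq_sum => i _; rewrite -big_split /=.
apply: (@leq_trans (\sum_(v : V) #|V|.-1)); last by rewrite sum_nat_const.
apply: leq_sum => v _; rewrite -big_split /= -(cardC1 v) -sum1_card [X in _ <= X]big_mkcond.
apply: leq_sum => x _; rewrite inE /= eq_sym.
by case: (x != v); case: (joins _ _ _ _).
Qed.

(** The minimum equals the number of colours, so no vertex lacks any colour. *)
Lemma incident_edge j x : rainbow_degree G = c ->
  exists2 y, y != x & joins G j x y.
Proof.
move=> rd; have := bigmin_le c (vertex_rainbow_degree G) x.
rewrite -/(rainbow_degree G) rd /vertex_rainbow_degree => le_c.
have : j \in [set e.2 | e in edges G & x \in e.1].
  suff -> : [set e.2 | e in edges G & x \in e.1] = setT by rewrite inE.
  by apply/eqP; rewrite eqEcard subsetT cardsT card_ord.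
case/imsetP => -[e i]; rewrite inE => /andP[eG /= xe] ->.
have /eqP/cards2P[y [z [yz eE]]] := edges_ends eG.
move: xe eG; rewrite /joins /= in eE *; rewrite eE !inE => /orP[] /eqP-> eG.
  by exists z; rewrite // eq_sym.
by exists y; rewrite // setUC.
Qed.

End Reduction.

Theorem theorem6 (c n m : nat) (V : finType) (G : ecmultigraph c V)
    (hc : 3 <= c) (hn : 4 <= n) (hV : #|V| = n) (hm : #|edges G| = m)
    (hconn : connected G)
    (hrd : rainbow_degree G = c)
    (hedges : c * 'C(n.-1, 2) + c + 1 <= m) :
  exists p : seq (V * 'I_c), proper_hamiltonian_cycle G p.
Proof.
(* The bound on [m] makes the average colour class larger than ['C(n.-1, 2) + 1]. *)
have [||A [cA sumA]] :=
  @above_average_subset 'I_c (fun j => #|colour_class G j|) ('C(n.-1, 2)).+1 _ 3.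
- by rewrite card_ord sum_colour_class hm mulnS; move: hedges; clear; lia.
- by rewrite card_ord.
have [k [f [k3 f_inj sumf]]] : exists k (f : 'I_k -> 'I_c),
    [/\ k = 3, injective f & 3 * ('C(n.-1, 2)).+1 < \sum_i #|colour_class G (f i)|].
  exists #|A|, enum_val; split; [by [] | exact: enum_val_inj |].
  by rewrite -(big_enum_val (fun j => #|colour_class G j|)).
have card_k : #|'I_k| = 3 by rewrite card_ord.
pose P i x y := joins G (f i) x y.
have Psym i : symmetric (P i) by exact: joins_sym.
have [||v _|p [cyc perm_p]] :=
    spanning_cycle_exists (P := P) Psym card_k (W := setT).
- by rewrite cardsT hV; apply: leq_trans hn.
(* The three classes have at least [3 'C(n.-1, 2) + 4] edges, hence miss at most
   [3(n - 1) - 4 = 3n - 7]. *)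
- have := total_colours G f; rewrite cardsT hV -/P [X in _ <= X * _]k3.
  have := double_bin2 n.-1; move: sumf; clear -hn.
  move: (\sum_i _) (total _ _) 'C(_, _) => s t b.
  by case: n hn => [|[|l]] //= _; nia.
- suff -> : colours P setT v = setT by rewrite cardsT card_k.
  apply/setP=> i; rewrite !inE; apply/existsP.
  have [y yv jy] := incident_edge (f i) v hrd.
  by exists y; rewrite !inE yv.
exists [seq (s.1, f s.2) | s <- p].
have unzipE : unzip1 [seq (s.1, f s.2) | s <- p] = unzip1 p.
  by rewrite /unzip1 -map_comp.
split; rewrite ?unzipE.
- rewrite cycle_map; apply: sub_cycle cyc => s t /andP[jst st].
  by rewrite /proper_step /= [joins _ _ _ _]jst (inj_eq f_inj).
- by rewrite (perm_uniq perm_p) enum_uniq.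
- by move=> x; rewrite (perm_mem perm_p) mem_enum inE.
Qed.
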